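(* Let $L$ be a set, and let $W, W'$ be two witness sets for $L$ with respect to maps $\Lambda : L \times W \to \mathbf{R}$ and $\Lambda' : L \times W' \to \mathbf{R}$ (i.e. $W,W'$ are sets equipped with such maps). If $C: W \rightrightarrows W'$ is a correspondence and $\varepsilon\in\mathbf{R}$ satisfies $\varepsilon \geq 2\, \mathrm{dis}(C)$, then the persistence modules $\mathrm{H}(\mathbb{W}\mathrm{it}(L,W))$ and $\mathrm{H}(\mathbb{W}\mathrm{it}(L,W'))$ are $\varepsilon$-interleaved.
   Context: Fix a field $\mathbf{k}$; $\mathrm{H}$ denotes (total) simplicial homology with coefficients in $\mathbf{k}$. A persistence module $\mathbb{V}$ is a family of $\mathbf{k}$-vector spaces $(V_a)_{a\in\mathbf{R}}$ with linear maps $v_a^b:V_a\to V_b$ for $a\le b$ such that $v_a^a=\mathrm{id}$ and $v_b^c\circ v_a^b=v_a^c$ for $a\le b\le c$. A homomorphism of degree $\varepsilon$, $\Phi\in\mathrm{Hom}^\varepsilon(\mathbb{U},\mathbb{V})$, is a family of linear maps $(\phi_a:U_a\to V_{a+\varepsilon})_{a\in\mathbf{R}}$ with $v_{a+\varepsilon}^{b+\varepsilon}\circ\phi_a=\phi_b\circ u_a^b$ for all $a\le b$. $\mathbb{U},\mathbb{V}$ are $\varepsilon$-interleaved if there are $\Phi\in\mathrm{Hom}^\varepsilon(\mathbb{U},\mathbb{V})$, $\Psi\in\mathrm{Hom}^\varepsilon(\mathbb{V},\mathbb{U})$ with $\psi_{a+\varepsilon}\circ\phi_a=u_a^{a+2\varepsilon}$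 and $\phi_{a+\varepsilon}\circ\psi_a=v_a^{a+2\varepsilon}$ for all $a$. A correspondence $C:W\rightrightarrows W'$ is a subset of $W\times W'$ projecting surjectively onto both factors; its distortion here is $\mathrm{dis}(C)=\sup_{l\in L}\sup_{(w,w')\in C}|\Lambda(l,w)-\Lambda'(l,w')|\in[0,+\infty]$ (with $\sup\emptyset=0$). Given sets $L$ (landmarks), $W$ (witnesses) and a function $\Lambda:L\times W\to\mathbf{R}$: for a finite subset $\tau\subseteq L$, $w\in W$ and $a\in\mathbf{R}$, $w$ is an $a$-witness for $\tau$ iff $\Lambda(l,w)\le\Lambda(l',w)+a$ for all $l\in\tau$ and $l'\in L\setminus\tau$. The witness complex $\mathrm{Wit}(L,W;a)$ is the simplicial complex whose simplices are the nonempty finite subsets $\sigma\subseteq L$ such that for every nonempty $\tau\subseteq\sigma$ there exists $w\in W$ which is an $a$-witness for $\tau$. $\mathbb{W}\mathrm{it}(L,W)$ is the filtered complex $(\mathrm{Wit}(L,W;a))_{a\in\mathbf{R}}$ and $\mathrm{H}(\mathbb{W}\mathrm{it}(L,W))$ is the persistence module $(\mathrm{H}(\mathrm{Wit}(L,W;a)))_a$ with maps induced by inclusions. $\mathbb{W}\mathrm{it}(L,W')$ is defined likewise using $\Lambda'$. *)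

(* Defs.v *)
From HB Require Import structures.
From mathcomp Require Import all_boot all_order all_algebra all_fingroup.
From mathcomp Require Import finmap all_classical all_reals ereal.

Set Implicit Arguments.
Unset Strict Implicit.
Unset Printing Implicit Defensive.

Import Order.TTheory GRing.Theory Num.Theory.

Local Open Scope classical_set_scope.
Local Open Scope ring_scope.

Section LmodQuotient.
Variables (k : pzRingType) (V : lmodType k) (S : submodClosed V).

Fact submod_zmod_closed : zmod_closed S.
Proof. exact/GRing.submod_closedB/GRing.submodClosedP. Qed.

Definition submod_zmodClosed : zmodClosed V := HB.pack_for (zmodClosed V)
  (GRing.SubmodClosed.sort S) (GRing.isZmodClosed.Build V (GRing.SubmodClosed.sort S) submod_zmod_closed).

Definition lquot : Type := Quotient.quot submod_zmodClosed.
HB.instance Definition _ := GRing.Zmodule.on lquot.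

Definition lpi (v : V) : lquot := \pi_(Quotient.quot submod_zmodClosed)%qT v.
Definition lrepr (x : lquot) : V := generic_quotient.repr (x : Quotient.quot submod_zmodClosed).

Lemma lreprK x : lpi (lrepr x) = x.
Proof. exact: generic_quotient.reprK. Qed.

Lemma lpi_eqP u v : reflect (lpi u = lpi v) (u - v \in S).
Proof. by rewrite -[_ \in S]/(_ \in submod_zmodClosed) Quotient.idealrBE; apply: eqP. Qed.

Lemma lpi_is_zmod_morphism : zmod_morphism lpi.
Proof. exact: (@pi_is_zmod_morphism _ _ _ (Quotient.quot submod_zmodClosed)). Qed.
HB.instance Definition _ :=
  GRing.isZmodMorphism.Build V lquot lpi lpi_is_zmod_morphism.

Definition lquot_scale (a : k) (x : lquot) : lquot := lpi (a *: lrepr x).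

Lemma lpiZ a v : lpi (a *: v) = lquot_scale a (lpi v).
Proof.
by apply/lpi_eqP; rewrite -scalerBr rpredZ //; apply/lpi_eqP; rewrite lreprK.
Qed.

Fact lquot_scaleA a b x :
  lquot_scale a (lquot_scale b x) = lquot_scale (a * b) x.
Proof. by rewrite -[x]lreprK -!lpiZ scalerA. Qed.
Fact lquot_scale1 : left_id 1 lquot_scale.
Proof. by move=> x; rewrite -[x]lreprK -lpiZ scale1r. Qed.
Fact lquot_scaleDr : right_distributive lquot_scale +%R.
Proof.
by move=> a x y; rewrite -[x]lreprK -[y]lreprK -raddfD -!lpiZ scalerDr raddfD.
Qed.
Fact lquot_scaleDl x : {morph lquot_scale^~ x : a b / a + b}.
Proof. by move=> a b; rewrite -[x]lreprK -!lpiZ scalerDl raddfD. Qed.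

HB.instance Definition _ := GRing.Zmodule_isLmodule.Build k lquot
  lquot_scaleA lquot_scale1 lquot_scaleDr lquot_scaleDl.

Fact lpi_scalable : scalable lpi.
Proof. by move=> a v; rewrite lpiZ. Qed.
HB.instance Definition _ :=
  GRing.isScalable.Build k V lquot *:%R lpi lpi_scalable.

End LmodQuotient.

Section LmodQuotientMap.
Variables (k : pzRingType) (V V' : lmodType k).
Variables (S : submodClosed V) (S' : submodClosed V').
Variable f : {linear V -> V'}.

Definition lquot_map (fS : forall v, v \in S -> f v \in S') (x : lquot S) :
  lquot S' := lpi S' (f (lrepr x)).

Lemma lquot_map_pi fS v : lquot_map fS (lpi S v) = lpi S' (f v).
Proof.
by apply/lpi_eqP; rewrite -linearB; apply/fS/lpi_eqP; rewrite lreprK.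
Qed.

Fact lquot_map_is_linear fS : linear (lquot_map fS).
Proof.
move=> a x y; rewrite -[x]lreprK -[y]lreprK -linearP !lquot_map_pi.
by rewrite !linearP.
Qed.
HB.instance Definition _ fS :=
  GRing.isLinear.Build k _ _ _ (lquot_map fS) (lquot_map_is_linear fS).

End LmodQuotientMap.
Arguments lquot_map {k V V'} S S' {f} fS x.

Section DirectSum.
Variables (k : pzRingType) (I : Type) (M : I -> lmodType k).

Record dsum := Dsum {
  dsum_fun :> forall i, M i;
  dsum_finite : finite_set [set i | dsum_fun i != 0]
}.

Lemma dsumP (x y : dsum) : (forall i, x i = y i) -> x = y.
Proof.
case: x y => [x xf] [y yf] /= xy; have {}xy : x = y by apply: functional_extensionality_dep.
by subst y; congr Dsum; exact: Prop_irrelevance.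
Qed.

HB.instance Definition _ := gen_eqMixin dsum.
HB.instance Definition _ := gen_choiceMixin dsum.

Fact dsum_finite0 : finite_set [set i | (0 : M i) != 0].
Proof. by apply: (sub_finite_set _ (@finite_set0 I)) => i /=; rewrite eqxx. Qed.
Fact dsum_finiteD (x y : dsum) : finite_set [set i | x i + y i != 0].
Proof.
have xyf : finite_set ([set i | x i != 0] `|` [set i | y i != 0]).
  by rewrite finite_setU; split; apply: dsum_finite.
apply: sub_finite_set xyf => i /= xy0; case: (eqVneq (x i) 0) => xi; last by left.
by right; move: xy0; rewrite xi add0r.
Qed.
Fact dsum_finiteN (x : dsum) : finite_set [set i | - x i != 0].
Proof.
by apply: sub_finite_set (dsum_finite x) => i /=; rewrite oppr_eq0.
Qed.
Fact dsum_finiteZ a (x : dsum) : finite_set [set i | a *: x i != 0].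
Proof.
apply: sub_finite_set (dsum_finite x) => i /=; apply: contra_neq => ->.
exact: scaler0.
Qed.

Definition dsum_zero := Dsum dsum_finite0.
Definition dsum_add x y := Dsum (dsum_finiteD x y).
Definition dsum_opp x := Dsum (dsum_finiteN x).
Definition dsum_scale a x := Dsum (dsum_finiteZ a x).

Fact dsum_addA : associative dsum_add.
Proof. by move=> x y z; apply: dsumP => i /=; rewrite addrA. Qed.
Fact dsum_addC : commutative dsum_add.
Proof. by move=> x y; apply: dsumP => i /=; rewrite addrC. Qed.
Fact dsum_add0 : left_id dsum_zero dsum_add.
Proof. by move=> x; apply: dsumP => i /=; rewrite add0r. Qed.
Fact dsum_addN : left_inverse dsum_zero dsum_opp dsum_add.
Proof. by move=> x; apply: dsumP => i /=; rewrite addNr. Qed.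
HB.instance Definition _ := GRing.isZmodule.Build dsum
  dsum_addA dsum_addC dsum_add0 dsum_addN.

Fact dsum_scaleA a b x : dsum_scale a (dsum_scale b x) = dsum_scale (a * b) x.
Proof. by apply: dsumP => i /=; rewrite scalerA. Qed.
Fact dsum_scale1 : left_id 1 dsum_scale.
Proof. by move=> x; apply: dsumP => i /=; rewrite scale1r. Qed.
Fact dsum_scaleDr : right_distributive dsum_scale +%R.
Proof. by move=> a x y; apply: dsumP => i /=; rewrite scalerDr. Qed.
Fact dsum_scaleDl x : {morph dsum_scale^~ x : a b / a + b}.
Proof. by move=> a b; apply: dsumP => i /=; rewrite scalerDl. Qed.
HB.instance Definition _ := GRing.Zmodule_isLmodule.Build k dsum
  dsum_scaleA dsum_scale1 dsum_scaleDr dsum_scaleDl.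

End DirectSum.

Section DirectSumMap.
Variables (k : pzRingType) (I : Type) (M N : I -> lmodType k).
Variable (f : forall i, {linear M i -> N i}).

Fact dsum_map_finite (x : dsum M) : finite_set [set i | f i (x i) != 0].
Proof.
apply: sub_finite_set (dsum_finite x) => i /=; apply: contra_neq => ->.
exact: linear0.
Qed.

Definition dsum_map (x : dsum M) : dsum N := Dsum (dsum_map_finite x).

Fact dsum_map_is_linear : linear dsum_map.
Proof. by move=> a x y; apply: dsumP => i /=; rewrite linearP. Qed.
HB.instance Definition _ :=
  GRing.isLinear.Build k _ _ _ dsum_map dsum_map_is_linear.

End DirectSumMap.

Record simplicial_complex (V : Type) := SimplicialComplex {
  simplex : set (set V);
  simplex_finite : forall s, simplex s -> finite_set s;
  simplex_nonempty : forall s, simplex s -> s !=set0;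
  simplex_face : forall s t, simplex s -> t `<=` s -> t !=set0 -> simplex t
}.

Definition fcons (V : Type) n (v : V) (s : 'I_n -> V) : 'I_n.+1 -> V :=
  fun i => if unlift ord0 i is Some j then s j else v.

Lemma fcons0 (V : Type) n v (s : 'I_n -> V) : fcons v s ord0 = v.
Proof. by rewrite /fcons unlift_none. Qed.

Lemma fconsS (V : Type) n v (s : 'I_n -> V) i : fcons v s (lift ord0 i) = s i.
Proof. by rewrite /fcons liftK. Qed.

Lemma fcons_eta (V : Type) n (s : 'I_n.+1 -> V) :
  fcons (s ord0) (s \o lift ord0) = s.
Proof.
by apply/funext => i; case: (unliftP ord0 i) => [j|] ->;
  rewrite ?fcons0 ?fconsS.
Qed.

Lemma fcons_perm (V : Type) n v (s : 'I_n -> V) (p : 'S_n) :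
  fcons v (s \o p) = fcons v s \o lift_perm ord0 ord0 p.
Proof.
apply/funext => i /=; case: (unliftP ord0 i) => [j|] ->.
  by rewrite lift_perm_lift !fconsS.
by rewrite lift_perm_id !fcons0.
Qed.

Lemma fsum_fset (T : choiceType) (M : nmodType) (A : set T) (f : T -> M) :
    finite_set A -> (forall x, f x != 0 -> A x) ->
  \sum_(x \in [set: T]) f x = \sum_(x <- fset_set A) f x.
Proof.
move=> Af fA; apply: fsbigTE => x; rewrite in_fset_set // => /negP xA.
by apply/eqP/negPn/negP => /fA xA'; apply: xA; rewrite inE.
Qed.

Section Chains.
Variables (k : fieldType) (V : Type).

Section Fixed.
Variables (K : simplicial_complex V) (n : nat).
Implicit Type c : ('I_n.+1 -> V) -> k^o.

(* An oriented [n]-chain: a finitely supported function on the orderings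
   [(s 0, ..., s n)] of the [n]-simplices of [K] which changes sign when the
   orientation is reversed. It is extended by zero to all [n.+1]-tuples. *)
Record is_chain c : Prop := IsChain {
  chain_finite : finite_set [set s | c s != 0];
  chain_inj : forall s, c s != 0 -> injective s;
  chain_simplex : forall s, c s != 0 -> simplex K (range s);
  chain_alt : forall s (p : 'S_n.+1), c (s \o p) = (-1) ^+ p * c s
}.

Definition chain_pred : {pred ('I_n.+1 -> V) -> k^o} := fun c => `[< is_chain c >].

Fact chain_pred_submod : submod_closed chain_pred.
Proof.
split; first apply/asboolP; [split|] => [|s|s|s p|].
- apply: (sub_finite_set _ (@finite_set0 _)) => s /=.
  by rewrite eqxx.
- by rewrite eqxx.
- by rewrite eqxx.
- by rewrite mulr0.
move=> a c d /asboolP cK /asboolP dK; apply/asboolP.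
have cd0 s : a * c s + d s != 0 -> c s != 0 \/ d s != 0.
  case: (eqVneq (c s) 0) => [->|]; last by left.
  by rewrite mulr0 add0r; right.
split=> [|s /cd0[]|s /cd0[]|s p].
- have : finite_set ([set s | c s != 0] `|` [set s | d s != 0]).
    by rewrite finite_setU; split; apply: chain_finite.
  by apply: sub_finite_set => s; apply: cd0.
- exact: chain_inj.
- exact: chain_inj.
- exact: chain_simplex.
- exact: chain_simplex.
- have E u : (a *: c + d) u = a * c u + d u :> k by [].
  by rewrite !E !(chain_alt cK, chain_alt dK) mulrDr mulrCA.
Qed.
HB.instance Definition _ := GRing.isSubmodClosed.Build k (('I_n.+1 -> V) -> k^o)
  chain_pred chain_pred_submod.

Record chain := Chain { chain_fun :> ('I_n.+1 -> V) -> k^o;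
                        chain_predP : chain_fun \in chain_pred }.
HB.instance Definition _ := [isSub for chain_fun].
HB.instance Definition _ := [Choice of chain by <:].
HB.instance Definition _ := [SubChoice_isSubLmodule of chain by <:].

Lemma chainP (c : chain) : is_chain c.
Proof. by apply/asboolP; exact: chain_predP. Qed.

End Fixed.

(* The linear extension of [v_0, ..., v_n] |-> \sum_i (-1)^i [.., ^v_i, ..] in
   terms of the function [c]: in the boundary of the oriented simplex [s], the
   ordered simplex [t] is reached exactly from the [v] with
   [(v, t_0, ..., t_n)] an ordering of [s]; see [boundary_oriented]. *)
Definition boundary_fun n (c : ('I_n.+2 -> V) -> k^o) : ('I_n.+1 -> V) -> k^o :=
  fun t => \sum_(v \in [set: {classic V}]) c (fcons v t).

(* The elementary chain [s_0, ..., s_n]; it vanishes if [s] is not injective. *)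
Definition oriented n (s : 'I_n.+1 -> V) : ('I_n.+1 -> V) -> k^o :=
  fun t => \sum_(p : 'S_n.+1 | `[< t = s \o p >]) (-1) ^+ p.


Lemma boundary_oriented n (s : 'I_n.+2 -> V) :
  boundary_fun (oriented s) =
  fun t => \sum_(i < n.+2) (-1) ^+ i * oriented (s \o lift i) t.
Proof.
apply/funext => t.
have sf : finite_set (range s : set {classic V}).
  exact: finite_image.
rewrite /boundary_fun (fsum_fset sf); last first.
  move=> v; apply: contraNP => vs; apply/eqP/big1 => p /asboolP tE.
  by exfalso; apply: vs; exists (p ord0) => //; rewrite -[RHS](fcons0 v t) tE.
pose F (p : 'S_n.+2) : k := if `[< t = s \o p \o lift ord0 >] then (-1) ^+ p else 0.
transitivity (\sum_(p : 'S_n.+2) F p).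
  rewrite /oriented; under eq_bigr => v _ do rewrite big_mkcond.
  rewrite exchange_big /=; apply: eq_bigr => p _.
  have ps : (s (p ord0) : {classic V}) \in fset_set (range s : set {classic V}).
    by rewrite in_fset_set //; apply/mem_set; exists (p ord0).
  rewrite (big_fsetD1 _ ps) /= big1_fset ?addr0; last first.
    move=> v; rewrite !inE => /andP[/eqP vp _] _.
    by case: asboolP => // tE; case: vp; rewrite -[LHS](fcons0 v t) tE.
  rewrite /F; congr (if _ then _ else _); apply: asbool_equiv_eq; split=> tE.
    by apply/funext => i; rewrite -[LHS](fconsS (s (p ord0)) t) tE.
  by rewrite tE; apply: (fcons_eta (s \o p)).
rewrite (partition_big (fun p : 'S_n.+2 => p ord0) predT) //=.
apply: eq_bigr => i _; rewrite (reindex (lift_perm ord0 i)) /=; last first.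
  pose ulsf j (p : 'S_n.+2) l := odflt l (unlift (p j) (p (lift j l))).
  have ulsfK j (p : 'S_n.+2) l : lift (p j) (ulsf j p l) = p (lift j l).
    rewrite /ulsf; have := neq_lift j l.
    by rewrite -(can_eq (permK p)) => /unlift_some[] ? ? ->.
  have inj_ulsf : injective (ulsf ord0 _).
    move=> p; apply: can_inj (ulsf (p ord0) p^-1%g) _ => l.
    by rewrite {1}/ulsf ulsfK !permK liftK.
  exists (fun p => perm (inj_ulsf p)) => [p _ | p].
    by apply/permP => l; rewrite permE /ulsf lift_perm_lift lift_perm_id liftK.
  move/(p _ =P _) => pi0; apply/permP => l.
  case: (unliftP ord0 l) => [l'|] ->; rewrite ?lift_perm_id //.
  by rewrite lift_perm_lift -pi0 permE ulsfK.
rewrite /oriented big_distrr /= [RHS]big_mkcond /=.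
apply: eq_big => [q|q _]; first by rewrite lift_perm_id eqxx.
rewrite /F odd_lift_perm /= signr_addb signr_odd.
congr (if _ then _ else _); apply: asbool_equiv_eq.
suff -> : s \o lift_perm ord0 i q \o lift ord0 = s \o lift i \o q by [].
by apply/funext => j /=; rewrite lift_perm_lift.
Qed.

Section Complex.
Variable K : simplicial_complex V.

Definition vertices_of n (c : ('I_n.+1 -> V) -> k^o) : set {classic V} :=
  \bigcup_(s in [set s | c s != 0]) range s.

Lemma vertices_of_finite n (c : chain K n) : finite_set (vertices_of c).
Proof.
apply: bigcup_finite; first exact: chain_finite (chainP c).
by move=> s _; exact: finite_image.
Qed.

Lemma boundary_funE n (c : chain K n.+1) (A : set {classic V}) t :
    finite_set A -> vertices_of c `<=` A ->
  boundary_fun c t = \sum_(v <- fset_set A) c (fcons v t).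
Proof.
move=> Af cA; apply: fsum_fset => // v cv; apply: cA.
by exists (fcons v t) => //; exists ord0; rewrite ?fcons0.
Qed.

Fact boundary_fun_chain n (c : chain K n.+1) :
  boundary_fun c \in @chain_pred K n.
Proof.
have bc0 t : boundary_fun c t != 0 -> exists v, c (fcons v t) != 0.
  move=> ct; apply: contrapT => /forallNP cv; move/eqP: ct; apply.
  by apply: fsbig1 => v _; apply/eqP/negPn/negP/cv.
have cP := chainP c.
apply/asboolP; split=> [|t /bc0[v]|t /bc0[v]|t p].
- have := finite_image (fun s : 'I_n.+2 -> V => s \o lift ord0) (chain_finite cP).
  apply: sub_finite_set => t /bc0[v cv]; exists (fcons v t) => //.
  by apply/funext => i; rewrite /= fconsS.
- move=> /(chain_inj cP) ct i j tij; apply: (@lift_inj _ ord0); apply: ct.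
  by rewrite !fconsS.
- move=> /(chain_simplex cP) Kt; apply: simplex_face Kt _ _.
    by move=> _ [i _ <-]; exists (lift ord0 i); rewrite ?fconsS.
  by exists (t ord0); exists ord0.
- rewrite !(boundary_funE _ (vertices_of_finite c)) // big_distrr /=.
  by apply: eq_bigr => v _; rewrite fcons_perm (chain_alt cP) odd_lift_perm.
Qed.

Definition boundary n (c : chain K n.+1) : chain K n := Chain (boundary_fun_chain c).

Fact boundary_is_linear n : linear (@boundary n).
Proof.
move=> a c d; apply: val_inj; apply/funext => t.
rewrite -[LHS]/(boundary_fun (a *: c + d)%R t).
pose A := vertices_of c `|` vertices_of d `|` vertices_of (a *: c + d).
have Af : finite_set A by rewrite !finite_setU; do !split; exact: vertices_of_finite.
rewrite (boundary_funE _ Af); last by move=> v; right.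
rewrite -[RHS]/(a * boundary_fun c t + boundary_fun d t).
rewrite !(boundary_funE _ Af); try by move=> v ?; left; (left + right).
by rewrite big_distrr -big_split.
Qed.
HB.instance Definition _ n :=
  GRing.isLinear.Build k _ _ _ (@boundary n) (@boundary_is_linear n).

Lemma boundaryK n (c : chain K n.+2) : boundary (boundary c) = 0.
Proof.
apply: val_inj; apply/funext => t /=.
have Af : finite_set (vertices_of c) := vertices_of_finite c.
have bA : vertices_of (boundary c) `<=` vertices_of c.
  move=> v [s /= bs vs]; have [w cw] : exists w, c (fcons w s) != 0.
    apply: contrapT => /forallNP cv; move/eqP: bs; apply.
    by apply: fsbig1 => w _; apply/eqP/negPn/negP/cv.
  case: vs => i _ <-; exists (fcons w s) => //.
  by exists (lift ord0 i); rewrite ?fconsS.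
rewrite (boundary_funE _ Af bA).
under eq_bigr => v _ do rewrite /= (boundary_funE _ Af) //.
pose f v w := c (fcons w (fcons v t)).
have fv v : f v v = 0.
  apply/eqP/negPn/negP => /(chain_inj (chainP c)) /(_ ord0 (lift ord0 ord0)).
  by rewrite fcons0 fconsS fcons0 => /(_ erefl).
have fN v w : f v w = - f w v.
  rewrite /f -[fcons w (fcons v t)](_ : fcons v (fcons w t) \o
     tperm ord0 (lift ord0 ord0) = _).
    by rewrite (chain_alt (chainP c)) odd_tperm /= expr1 mulN1r.
  apply/funext => i /=; case: (unliftP ord0 i) => [j|] ->; last first.
    by rewrite tpermL fconsS !fcons0.
  case: (unliftP ord0 j) => [l|] ->; last by rewrite tpermR fconsS !fcons0.
  by rewrite tpermD ?fconsS ?neq_lift.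
rewrite -[LHS]/(\sum_(v <- fset_set (vertices_of c))
                 \sum_(w <- fset_set (vertices_of c)) f v w).
elim: (enum_fset _) => [|x r IH]; first by rewrite big_nil.
rewrite big_cons [in X in X + _]big_cons fv add0r.
under [in X in _ + X]eq_bigr => v _ do rewrite big_cons.
rewrite big_split /= IH addr0 -big_split /= big1 // => v _.
by rewrite fN addNr.
Qed.

(* Homology is not reduced: every 0-chain is a cycle. *)
Definition cycle_pred n : {pred chain K n} :=
  match n return {pred chain K n} with
  | 0 => fun=> true
  | m.+1 => fun c => boundary c == 0
  end.

Fact cycle_pred_submod n : submod_closed (@cycle_pred n).
Proof.
case: n => [|n]; first by [].
split; first by rewrite unfold_in /= linear0.
move=> a c d; rewrite !unfold_in /= => /eqP c0 /eqP d0.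
by rewrite linearP /= c0 d0 scaler0 addr0.
Qed.
HB.instance Definition _ n := GRing.isSubmodClosed.Build k (chain K n)
  (@cycle_pred n) (@cycle_pred_submod n).

Record cycles n := Cycle { cycle_chain :> chain K n;
                          cycle_predP : cycle_chain \in @cycle_pred n }.
HB.instance Definition _ n := [isSub for @cycle_chain n].
HB.instance Definition _ n := [Choice of cycles n by <:].
HB.instance Definition _ n := [SubChoice_isSubLmodule of cycles n by <:].

Definition bounding n : {pred cycles n} :=
  fun z => `[< exists c : chain K n.+1, boundary c = z >].

Lemma boundary_cycle n (c : chain K n.+1) : boundary c \in @cycle_pred n.
Proof. by case: n c => // n c; rewrite unfold_in /= boundaryK. Qed.

Fact bounding_submod n : submod_closed (@bounding n).
Proof.
split; first by apply/asboolP; exists 0; rewrite linear0.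
move=> a y z /asboolP[c cy] /asboolP[d dz]; apply/asboolP; exists (a *: c + d).
by rewrite linearP /= cy dz.
Qed.
HB.instance Definition _ n := GRing.isSubmodClosed.Build k (cycles n)
  (@bounding n) (@bounding_submod n).

Definition homology_deg n : lmodType k := lquot (@bounding n).

Definition homology : lmodType k := dsum homology_deg.

End Complex.
Section Inclusion.
Variables (K K' : simplicial_complex V) (KK' : simplex K `<=` simplex K').

Fact chain_incl_subproof n (c : chain K n) :
  (c : ('I_n.+1 -> V) -> k^o) \in @chain_pred K' n.
Proof.
have cP := chainP c; apply/asboolP; split.
- exact: chain_finite cP.
- exact: chain_inj cP.
- by move=> s cs; apply/KK'/(chain_simplex cP).
- exact: chain_alt cP.
Qed.

Definition chain_incl n (c : chain K n) : chain K' n :=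
  Chain (chain_incl_subproof c).

Fact chain_incl_is_linear n : linear (@chain_incl n).
Proof. by move=> a c d; apply: val_inj. Qed.
HB.instance Definition _ n :=
  GRing.isLinear.Build k _ _ _ (@chain_incl n) (@chain_incl_is_linear n).

Lemma boundary_incl n (c : chain K n.+1) :
  boundary (chain_incl c) = chain_incl (boundary c).
Proof. exact: val_inj. Qed.

Fact cycles_incl_subproof n (z : cycles K n) :
  chain_incl z \in @cycle_pred K' n.
Proof.
case: n z => [|n] z; first by [].
have := cycle_predP z; rewrite !unfold_in /= boundary_incl => /eqP ->.
by rewrite linear0.
Qed.

Definition cycles_incl n (z : cycles K n) : cycles K' n :=
  Cycle (cycles_incl_subproof z).

Fact cycles_incl_is_linear n : linear (@cycles_incl n).
Proof. by move=> a y z; do 2 apply: val_inj. Qed.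
HB.instance Definition _ n :=
  GRing.isLinear.Build k _ _ _ (@cycles_incl n) (@cycles_incl_is_linear n).

Fact bounding_incl n (z : cycles K n) :
  z \in @bounding K n -> cycles_incl z \in @bounding K' n.
Proof.
move=> /asboolP[c cz]; apply/asboolP; exists (chain_incl c).
by rewrite boundary_incl cz.
Qed.

Definition homology_deg_map n :
    {linear homology_deg K n -> homology_deg K' n} :=
  lquot_map (@bounding K n) (@bounding K' n) (@bounding_incl n).

Definition homology_map : {linear homology K -> homology K'} :=
  dsum_map homology_deg_map.

End Inclusion.

Lemma homology_map_id (K : simplicial_complex V)
    (KK : simplex K `<=` simplex K) x : homology_map KK x = x.
Proof.
apply: dsumP => n /=; rewrite -[x n]lreprK /= lquot_map_pi.
by congr lpi; do 2 apply: val_inj.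
Qed.

Lemma homology_map_comp (K1 K2 K3 : simplicial_complex V)
    (K12 : simplex K1 `<=` simplex K2) (K23 : simplex K2 `<=` simplex K3)
    (K13 : simplex K1 `<=` simplex K3) x :
  homology_map K23 (homology_map K12 x) = homology_map K13 x.
Proof.
apply: dsumP => n /=; rewrite -[x n]lreprK /= !lquot_map_pi.
by congr lpi; do 2 apply: val_inj.
Qed.

End Chains.

Section Persistence.
Variables (k : fieldType) (R : realType).

Record persistence_module := PersistenceModule {
  pm_space :> R -> lmodType k;
  pm_map : forall a b, a <= b -> {linear pm_space a -> pm_space b};
  pm_id : forall a (aa : a <= a) x, pm_map aa x = x;
  pm_comp : forall a b c (ab : a <= b) (bc : b <= c) (ac : a <= c) x,
    pm_map bc (pm_map ab x) = pm_map ac x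
}.

Record pm_hom (e : R) (U V : persistence_module) := PmHom {
  pm_hom_fun :> forall a, {linear U a -> V (a + e)};
  pm_hom_natural : forall a b (ab : a <= b) (abe : a + e <= b + e) x,
    pm_map V abe (pm_hom_fun a x) = pm_hom_fun b (pm_map U ab x)
}.

Fact le_shift2 (e : R) : 0 <= e -> forall a, a <= a + e + e.
Proof. by move=> e0 a; rewrite -addrA lerDl addr_ge0. Qed.

(* The structure maps [u_a^(a + 2 e)] only exist when [0 <= e], which is part
   of the definition; [a + 2 e] is written [a + e + e], the index at which the
   composites land. *)
Definition interleaved (e : R) (U V : persistence_module) : Prop :=
  exists (e0 : 0 <= e) (Phi : pm_hom e U V) (Psi : pm_hom e V U),
    (forall a x, Psi (a + e) (Phi a x) = pm_map U (le_shift2 e0 a) x) /\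
    (forall a y, Phi (a + e) (Psi a y) = pm_map V (le_shift2 e0 a) y).

End Persistence.

Record filtered_complex (R : realType) (V : Type) := FilteredComplex {
  fcomplex :> R -> simplicial_complex V;
  fcomplex_incr : forall a b, a <= b ->
    simplex (fcomplex a) `<=` simplex (fcomplex b)
}.

Arguments fcomplex_incr {R V} f {a b} ab.

Definition persistent_homology (k : fieldType) (R : realType) (V : Type)
    (F : filtered_complex R V) : persistence_module k R :=
  @PersistenceModule k R (fun a => homology k (F a))
    (fun a b ab => homology_map k (fcomplex_incr F ab))
    (fun a aa x => homology_map_id (fcomplex_incr F aa) x)
    (fun a b c ab bc ac x => homology_map_comp (fcomplex_incr F ab)
       (fcomplex_incr F bc) (fcomplex_incr F ac) x).

Section Witness.
Variables (R : realType) (L W : Type) (Lambda : L * W -> R).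

Definition is_witness (a : R) (w : W) (t : set L) : Prop :=
  forall l l', t l -> ~ t l' -> Lambda (l, w) <= Lambda (l', w) + a.

Definition wit_simplex (a : R) : set (set L) :=
  [set s | [/\ finite_set s, s !=set0 &
    forall t, t `<=` s -> t !=set0 -> exists w, is_witness a w t]].

Fact wit_simplex_finite a s : wit_simplex a s -> finite_set s.
Proof. by case. Qed.

Fact wit_simplex_nonempty a s : wit_simplex a s -> s !=set0.
Proof. by case. Qed.

Fact wit_simplex_face a s t :
  wit_simplex a s -> t `<=` s -> t !=set0 -> wit_simplex a t.
Proof.
move=> [sf _ sw] ts t0; split=> //; first exact: sub_finite_set sf.
by move=> u ut; apply: sw; apply: subset_trans ts.
Qed.

Definition Wit (a : R) : simplicial_complex L := SimplicialComplex
  (@wit_simplex_finite a) (@wit_simplex_nonempty a) (@wit_simplex_face a).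

Fact Wit_incr a b : a <= b -> simplex (Wit a) `<=` simplex (Wit b).
Proof.
move=> ab s [sf s0 sw]; split=> // t ts t0; have [w wt] := sw t ts t0.
by exists w => l l' tl tl'; apply: le_trans (wt l l' tl tl') _; rewrite lerD2l.
Qed.

Definition filtered_Wit : filtered_complex R L := FilteredComplex Wit_incr.

End Witness.

Definition correspondence (W W' : Type) (C : set (W * W')) : Prop :=
  (forall w, exists w', C (w, w')) /\ (forall w', exists w, C (w, w')).

(* The supremum in [0, +oo], so that the supremum of the empty set is 0
   instead of -oo. *)
Definition sup0 (R : realType) (A : set (\bar R)) : \bar R :=
  ereal_sup (0%E |` A).

Definition distortion (R : realType) (L W W' : Type)
    (Lambda : L * W -> R) (Lambda' : L * W' -> R) (C : set (W * W')) : \bar R :=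
  sup0 [set sup0 [set `|Lambda (l, p.1) - Lambda' (l, p.2)|%:E | p in C]
       | l in [set: L]].

(* Main.v *)
Require Import Defs.
From mathcomp Require Import all_boot all_order all_algebra.
From mathcomp Require Import all_classical all_reals ereal.
From mathcomp Require Import lra.

(** Moving from a witness [w] to a corresponding witness [w'] changes each value
    [Lambda (l, w)] by at most the distortion [d]. The inequality expressing
    that [w] is an [a]-witness compares two such values, so [w'] is an
    [(a + 2 d)]-witness for the same set of landmarks ([Wit_shift]). Both
    witness complexes have vertex set [L]; hence the identity of [L] includes
    each of the two filtrations in the other one shifted by [e >= 2 d]. All maps
    in the interleaving diagrams are then induced by inclusions of complexes, and
    functoriality of homology makes these diagrams commute
    ([persistent_homology_interleaved]). *)

Set Implicit Arguments.
Unset Strict Implicit.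
Unset Printing Implicit Defensive.

Import Order.TTheory GRing.Theory Num.Theory.

Local Open Scope classical_set_scope.
Local Open Scope ring_scope.

Definition shift_included (R : realType) (V : Type) (e : R)
    (F G : filtered_complex R V) : Prop :=
  forall a, simplex (F a) `<=` simplex (G (a + e)).

Section Interleaving.
Variables (k : fieldType) (R : realType) (V : Type) (e : R).
Implicit Types F G : filtered_complex R V.

(** Both sides of the naturality square are induced by the single inclusion
    of [F a] in [G (b + e)]. *)
Fact shift_map_natural F G (FG : shift_included e F G) a b
    (ab : a <= b) (abe : a + e <= b + e) (x : persistent_homology k F a) :
  pm_map (persistent_homology k G) abe (homology_map k (FG a) x) =
  homology_map k (FG b) (pm_map (persistent_homology k F) ab x).
Proof.
have FGab := subset_trans (FG a) (fcomplex_incr G abe).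
rewrite [LHS](homology_map_comp (FG a) (fcomplex_incr G abe) FGab).
by rewrite [RHS](homology_map_comp (fcomplex_incr F ab) (FG b) FGab).
Qed.

Definition shift_map F G (FG : shift_included e F G) :
    pm_hom e (persistent_homology k F) (persistent_homology k G) :=
  @PmHom k R e (persistent_homology k F) (persistent_homology k G)
    (fun a => homology_map k (FG a)) (shift_map_natural FG).

Lemma persistent_homology_interleaved F G :
  0 <= e -> shift_included e F G -> shift_included e G F ->
  interleaved e (persistent_homology k F) (persistent_homology k G).
Proof.
move=> e0 FG GF; exists e0, (shift_map FG), (shift_map GF).
by split=> a x; apply: homology_map_comp.
Qed.

End Interleaving.

(** The defect is paid twice, once for each of the two landmarks that are
    compared in the definition of a witness; this is where the factor 2 comes
    from. *)
Lemma Wit_shift (R : realType) (L W W' : Type)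
    (Lambda : L * W -> R) (Lambda' : L * W' -> R) (e : R) :
  (forall w, exists w', forall l,
     2 * `|Lambda (l, w) - Lambda' (l, w')| <= e) ->
  shift_included e (filtered_Wit Lambda) (filtered_Wit Lambda').
Proof.
move=> close a s [sf s0 sw]; split=> // t ts t0.
have [w wt] := sw t ts t0; have [w' ww'] := close w.
exists w' => l l' tl tl'; have := wt l l' tl tl'.
have := ler_norm (Lambda (l', w) - Lambda' (l', w')).
have := ler_norm (Lambda' (l, w') - Lambda (l, w)); rewrite distrC.
by have := ww' l; have := ww' l'; lra.
Qed.

Section Distortion.
Variables (R : realType) (L W W' : Type).
Variables (Lambda : L * W -> R) (Lambda' : L * W' -> R) (C : set (W * W')).

Lemma distortion_ge0 : (0 <= distortion Lambda Lambda' C)%E.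
Proof. by apply: ereal_sup_ubound; left. Qed.

Lemma distortion_ge l w w' : C (w, w') ->
  (`|Lambda (l, w) - Lambda' (l, w')|%:E <= distortion Lambda Lambda' C)%E.
Proof.
move=> Cww'; pose D l := Defs.sup0
  [set `|Lambda (l, p.1) - Lambda' (l, p.2)|%:E | p in C].
apply: (@le_trans _ _ (D l)); apply: ereal_sup_ubound; right.
  by exists (w, w').
by exists l.
Qed.

End Distortion.

Theorem lemma4p12 (k : fieldType) (R : realType) (L W W' : Type)
    (Lambda : L * W -> R) (Lambda' : L * W' -> R) (C : set (W * W')) (e : R) :
  correspondence C ->
  (2%:E * distortion Lambda Lambda' C <= e%:E)%E ->
  interleaved e (persistent_homology k (filtered_Wit Lambda))
                (persistent_homology k (filtered_Wit Lambda')).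
Proof.
move=> [CW CW'] disC.
have le_e (x : R) : (x%:E <= distortion Lambda Lambda' C)%E -> 2 * x <= e.
  move=> xd; rewrite -lee_fin EFinM; apply: le_trans disC.
  by apply: lee_wpmul2l => //; rewrite lee_fin.
apply: persistent_homology_interleaved.
- by rewrite -(mulr0 2); apply/le_e/distortion_ge0.
- apply: Wit_shift => w; have [w' Cww'] := CW w.
  by exists w' => l; apply/le_e/distortion_ge.
- apply: Wit_shift => w'; have [w Cww'] := CW' w'.
  by exists w => l; rewrite distrC; apply/le_e/distortion_ge.
Qed.
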